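(* Let $\lambda=(\lambda_1\ge\cdots\ge\lambda_N)$ be a signature of size $N$ and let $1\le k\le N$. Then, as an identity of rational functions in $x_1,\dots,x_k$, $$S_\lambda(x_1,\dots,x_k;N,1)=\frac{1}{\Delta(x_1,\dots,x_k)}\det\left[\sum_{\ell=0}^{j-1}\frac{D_{i,1}^{\ell}\bigl[S_\lambda(x_i;N,1)\bigr]}{N^\ell}\,P_{j,\ell,N}(x_i)\,(x_i-1)^{\ell+k-j}\right]_{i,j=1}^k,$$ where $D_{i,1}=x_i\frac{\partial}{\partial x_i}$ and, for integers $0\le\ell<j\le N$, $$P_{j,\ell,N}(x)=\binom{j-1}{\ell}\frac{N^\ell(N-j)!}{(N-1)!}(x-1)^{j-\ell-N}\left[\left(x\frac{\partial}{\partial x}\right)^{j-1-\ell}(x-1)^{N-1}\right].$$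
   Context: A signature of size $N$ is an $N$-tuple of integers $\lambda_1\ge\cdots\ge\lambda_N$. $\Delta(x_1,\dots,x_k)=\prod_{i<j}(x_i-x_j)$. The Schur function is the symmetric Laurent polynomial $s_\lambda(u_1,\dots,u_N)=\det[u_i^{\lambda_j+N-j}]_{i,j=1}^N/\prod_{i<j}(u_i-u_j)$ and $S_\lambda(x_1,\dots,x_k;N,1)=s_\lambda(x_1,\dots,x_k,1^{N-k})/s_\lambda(1^N)$, where $1^m$ stands for $m$ arguments equal to $1$. *)

(* Defs.v *)
From Stdlib Require Import ClassicalEpsilon.
From mathcomp Require Import all_boot all_order all_algebra.
From mathcomp Require Export mpoly.

Set Implicit Arguments.
Unset Strict Implicit.
Unset Printing Implicit Defensive.

Import Order.TTheory GRing.Theory Num.Theory.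
Local Open Scope ring_scope.

(* The field R(x_1, ..., x_n) of rational functions. *)
Notation ratfun R n := {fraction {mpoly R[n]}}.

Definition rfX (R : fieldType) (n : nat) (i : 'I_n) : ratfun R n :=
  FracField.tofrac ('X_i : {mpoly R[n]}).

Definition rfC (R : fieldType) (n : nat) : {rmorphism R -> ratfun R n} :=
  (@FracField.tofrac {mpoly R[n]} \o @mpolyC n R : {rmorphism _ -> _}).

(* Quotient rule, applied to some fraction p / q representing f; the result
   does not depend on the representative. *)
Definition rf_deriv (R : fieldType) (n : nat) (i : 'I_n) (f : ratfun R n) :
    ratfun R n :=
  let p := \n_(repr f) in
  let q := \d_(repr f) in
  FracField.tofrac (mderiv i p * q - p * mderiv i q) /
  FracField.tofrac (q ^+ 2).

(* D_{i,1} = x_i d/dx_i *)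
Definition rf_euler (R : fieldType) (n : nat) (i : 'I_n) (f : ratfun R n) :
    ratfun R n :=
  rfX R i * rf_deriv i f.

Definition vdm (K : fieldType) (n : nat) (x : 'I_n -> K) : K :=
  \prod_(i < n) \prod_(j < n | (i < j)%N) (x i - x j).

Definition is_signature (N : nat) (lam : 'I_N -> int) : Prop :=
  forall i j : 'I_N, (i <= j)%N -> lam j <= lam i.

(* Indices start at 0, whence the exponent lam j + N - (j + 1). *)
Definition schur (R : fieldType) (N : nat) (lam : 'I_N -> int) : ratfun R N :=
  \det (\matrix_(i < N, j < N) rfX R i ^ (lam j + N%:Z - j.+1%:Z)) /
  vdm (rfX R (n := N)).

(* f = p / (u_1 ... u_N)^m, i.e. f is the Laurent polynomial
   (u_1 ... u_N)^(-m) p. *)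
Definition laurent_form (R : fieldType) (N : nat) (f : ratfun R N)
    (pm : {mpoly R[N]} * nat) : Prop :=
  f = FracField.tofrac pm.1 / (\prod_(i < N) rfX R i) ^+ pm.2.

(* Value of the Laurent polynomial f at a point v with nonzero coordinates in
   an extension K of R.  It does not depend on the Laurent form chosen; it is
   unspecified when f is not a Laurent polynomial.  Going through the Laurent
   form is what makes sense of Schur functions at points where the defining
   quotient of determinants reads 0 / 0. *)
Definition laurent_eval (R K : fieldType) (iota : {rmorphism R -> K})
    (N : nat) (f : ratfun R N) (v : 'I_N -> K) : K :=
  let pm := epsilon (inhabits (0, 0%N)) (laurent_form f) in
  mmap iota v pm.1 / (\prod_(i < N) v i) ^+ pm.2.

(* s_lam(x_1, ..., x_k, 1^(N-k)), where xs = [:: x_1; ...; x_k] and k <= N. *)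
Definition schur_at (R K : fieldType) (iota : {rmorphism R -> K})
    (N : nat) (lam : 'I_N -> int) (xs : seq K) : K :=
  laurent_eval iota (schur R lam) (fun i : 'I_N => nth 1 xs i).

(* S_lam(x_1, ..., x_k; N, 1) *)
Definition schur_norm (R K : fieldType) (iota : {rmorphism R -> K})
    (N : nat) (lam : 'I_N -> int) (xs : seq K) : K :=
  schur_at iota lam xs / schur_at iota lam [::].

(* x d/dx on univariate polynomials *)
Definition poly_euler (K : fieldType) (p : {poly K}) : {poly K} := 'X * p^`().

(* P_{j,l,N}(x), for 0 <= l < j <= N *)
Definition Pjl (K : fieldType) (j l N : nat) (x : K) : K :=
  'C(j.-1, l)%:R * (N%:R ^+ l * (N - j)`!%:R / (N.-1)`!%:R) *
  (x - 1) ^ (j%:Z - l%:Z - N%:Z) *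
  (iter (j.-1 - l) (@poly_euler K) (('X - 1) ^+ N.-1)).[x].

(* Main.v *)
(** Let mu_a = lam_a + N - a.  Newton interpolation at the nodes
    (x_1, ..., x_k, 1^m), m = N - k, turns the alternant defining the Schur
    function into a Vandermonde factor times a determinant of divided
    differences, which still makes sense at coinciding nodes.  Hence
    s_lam(x_1, ..., x_k, 1^m) is, up to a Vandermonde factor, the determinant
    of an N x N matrix M whose first k rows are x_i^mu_a and whose other rows
    are polynomials in mu_a of degrees m - 1, ..., 0.
    Multiply M on the right by diag(w) V, where V = (mu_a^j) and
    w_a = prod_(b <> a) (mu_a - mu_b)^-1 are the Lagrange weights.  Since
    sum_a w_a q(mu_a) is the coefficient of degree N - 1 of q when
    deg q < N, the product is block upper triangular with upper left block
    sum_a w_a mu_a^j x_i^mu_a.  The cases k = 0 and k = 1 give the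
    normalisation and S(x) (x - 1)^(N-1) = (N-1)! sum_a w_a x^mu_a, so the
    upper left block is, up to constants, D_i^j [S(x_i) (x_i - 1)^(N-1)], which
    the Leibniz rule expands into the entries of the theorem. *)
Require Import Defs.
From Stdlib Require Import ClassicalEpsilon FunctionalExtensionality.
From mathcomp Require Import all_boot all_order all_algebra zify ring.

Set Implicit Arguments.
Unset Strict Implicit.
Unset Printing Implicit Defensive.

Import Order.TTheory GRing.Theory Num.Theory.
Local Open Scope ring_scope.

(** * Newton interpolation at confluent nodes *)

(** Divide by X minus the last node: the remainder is the coefficient of the last index, whose basis
    element is an empty product, and the quotient is expanded at the earlier nodes. Only monic
    divisors occur, so the ring may be one of multivariate polynomials and nodes may repeat. *)
Lemma newton_expansion (A : comNzRingType) (n : nat) (u : 'I_n -> A)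
    (p : {poly A}) :
  exists (c : nat -> A) (q : {poly A}),
    p = \sum_(l < n) c l *: \prod_(a < n | (l < a)%N) ('X - (u a)%:P)
        + q * \prod_(a < n) ('X - (u a)%:P).
Proof.
elim: n u p => [|n IHn] u p.
  by exists (fun=> 0), p; rewrite !big_ord0 mulr1 add0r.
have /factor_theorem [q Dp] : root (p - (p.[u ord_max])%:P) (u ord_max).
  by rewrite /root !hornerE subrr.
have [c [q' Dq]] := IHn (u \o widen_ord (leqnSn n)) q.
exists (fun l => if l == n then p.[u ord_max] else c l), q'.
rewrite big_ord_recr /= eqxx [X in _ + _ *: X + _]big_pred0 => [|a]; last first.
  by apply/negbTE; rewrite -leqNgt -ltnS.
rewrite [X in _ + q' * X]big_ord_recr /= mulrA alg_polyC.
rewrite -{1}(subrK (p.[u ord_max])%:P p) Dp {1}Dq mulrDl mulr_suml addrAC.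
congr (_ + _ + _); apply: eq_bigr => l _.
rewrite ltn_eqF // -scalerAl; congr (_ *: _).
by rewrite [RHS]big_mkcond big_ord_recr /= ltn_ord -big_mkcond.
Qed.

(** The matrix factors as L C, where L holds the values of the forms on the Newton basis and is
    upper triangular. At given nodes the same C serves every such family of forms: this is how plain
    evaluations and confluent forms come to share one determinant of divided differences. *)
Lemma det_linear_forms_newton (A : comNzRingType) (n : nat) (u : 'I_n -> A)
    (phi : 'I_n -> {scalar {poly A}}) (p q : 'I_n -> {poly A}) (C : 'M[A]_n) :
  (forall i r, phi i (r * \prod_(a < n) ('X - (u a)%:P)) = 0) ->
  (forall i l : 'I_n, (l < i)%N ->
     phi i (\prod_(a < n | (l < a)%N) ('X - (u a)%:P)) = 0) ->
  (forall j, p j = \sum_l C l j *: \prod_(a < n | (l < a)%N) ('X - (u a)%:P)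
                   + q j * \prod_(a < n) ('X - (u a)%:P)) ->
  \det (\matrix_(i, j) phi i (p j)) =
  (\prod_i phi i (\prod_(a < n | (i < a)%N) ('X - (u a)%:P))) * \det C.
Proof.
move=> phi_q phi_trig Dp.
pose L := \matrix_(i < n, l < n)
  phi i (\prod_(a < n | (l < a)%N) ('X - (u a)%:P)).
have -> : \matrix_(i, j) phi i (p j) = L *m C.
  apply/matrixP=> i j; rewrite !mxE Dp linearD phi_q addr0 linear_sum.
  by apply: eq_bigr => l _; rewrite linearZ !mxE mulrC.
rewrite det_mulmx -det_tr det_trig.
  by congr (_ * _); apply: eq_bigr => i _; rewrite !mxE.
by apply/is_trig_mxP => l i lt_li; rewrite !mxE phi_trig.
Qed.

Definition confluent_nodes (A : nzRingType) (k m : nat) (x : 'I_k -> A)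
    (i : 'I_(k + m)) : A :=
  match split i with inl a => x a | inr _ => 1 end.

(* The last m forms read off the coefficients of (X - 1)^(m-1), ..., 1. *)
Definition confluent_form (A : comNzRingType) (k m : nat) (x : 'I_k -> A)
    (i : 'I_(k + m)) : {scalar {poly A}} :=
  match split i with
  | inl a => horner_eval (x a)
  | inr r => coefp (m - r.+1) \o comp_poly ('X + 1)
  end.

Lemma prod_ord_gt (A : comNzRingType) (m r : nat) (x : A) :
  \prod_(s < m | (r < s)%N) x = x ^+ (m - r.+1).
Proof.
elim: m => [|m IHm]; first by rewrite big_ord0.
rewrite big_mkcond big_ord_recr -big_mkcond /= IHm.
case: ltnP => [lt_rm|le_mr]; first by rewrite subSS -exprSr subnSK.
by rewrite mulr1; congr (_ ^+ _); lia.
Qed.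

Section Confluent.

Variables (A : comNzRingType) (k m : nat) (x : 'I_k -> A).

Notation u := (confluent_nodes (m := m) x).
Notation phi := (confluent_form (m := m) x).

Lemma confluent_nodesl a : u (lshift m a) = x a.
Proof. by rewrite /confluent_nodes (unsplitK (inl a)). Qed.

Lemma confluent_nodesr r : u (rshift k r) = 1.
Proof. by rewrite /confluent_nodes (unsplitK (inr r)). Qed.

Lemma confluent_forml a p : phi (lshift m a) p = p.[x a].
Proof. by rewrite /confluent_form (unsplitK (inl a)). Qed.

Lemma confluent_formr r p : phi (rshift k r) p = (p \Po ('X + 1))`_(m - r.+1).
Proof. by rewrite /confluent_form (unsplitK (inr r)). Qed.

(** The substitution of X + 1 for X turns (X - 1)^d into X^d, which only shifts coefficients. *)
Lemma confluent_formr_exp r p d :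
  phi (rshift k r) (p * ('X - 1) ^+ d) =
  if (m - r.+1 < d)%N then 0 else (p \Po ('X + 1))`_(m - r.+1 - d).
Proof.
have E : ('X - 1) ^+ d \Po ('X + 1) = 'X^d :> {poly A}.
  by rewrite rmorphXn /= rmorphB /= comp_polyX rmorph1 addrK.
by rewrite confluent_formr comp_polyM E coefMXn.
Qed.

Lemma prod_confluent_nodes_gtl (a : 'I_k) :
  \prod_(b < k + m | (lshift m a < b)%N) ('X - (u b)%:P) =
  (\prod_(b < k | (a < b)%N) ('X - (x b)%:P)) * ('X - 1) ^+ m.
Proof.
rewrite big_split_ord /=; congr (_ * _).
  by apply: eq_bigr => b _; rewrite confluent_nodesl.
rewrite -[in RHS](card_ord m) -prodr_const; apply: eq_big => s.
  by rewrite (leq_trans (ltn_ord a)) ?leq_addr.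
by rewrite confluent_nodesr.
Qed.

Lemma prod_confluent_nodes_gtr (r : 'I_m) :
  \prod_(b < k + m | (rshift k r < b)%N) ('X - (u b)%:P) =
  ('X - 1) ^+ (m - r.+1).
Proof.
rewrite big_split_ord /= big_pred0 ?mul1r => [|b]; last first.
  by apply/negbTE; rewrite -leqNgt (leq_trans (ltnW (ltn_ord b))) ?leq_addr.
rewrite -prod_ord_gt; apply: eq_big => s; first by rewrite ltn_add2l.
by rewrite confluent_nodesr.
Qed.

Lemma prod_confluent_nodes :
  \prod_(b < k + m) ('X - (u b)%:P) =
  (\prod_(b < k) ('X - (x b)%:P)) * ('X - 1) ^+ m.
Proof.
rewrite big_split_ord /=; congr (_ * _).
  by apply: eq_bigr => b _; rewrite confluent_nodesl.
rewrite -[in RHS](card_ord m) -prodr_const.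
by apply: eq_bigr => s _; rewrite confluent_nodesr.
Qed.

(** An evaluation form meets its own factor X - x_a; a coefficient form reads an index below m in a
    multiple of (X - 1)^m. *)
Lemma confluent_form_prod0 i r :
  phi i (r * \prod_(a < k + m) ('X - (u a)%:P)) = 0.
Proof.
case: (split_ordP i) => [a|s] ->.
  rewrite confluent_forml hornerM horner_prod (bigD1 (lshift m a)) //=.
  by rewrite confluent_nodesl !hornerE subrr /= mulr0 mul0r.
by rewrite prod_confluent_nodes mulrA confluent_formr_exp ltn_subrL /=
    (leq_ltn_trans _ (ltn_ord s)).
Qed.

Lemma confluent_form_trig (i l : 'I_(k + m)) : (l < i)%N ->
  phi i (\prod_(a < k + m | (l < a)%N) ('X - (u a)%:P)) = 0.
Proof.
case: (split_ordP i) => [a|s] -> lt_li.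
  rewrite confluent_forml horner_prod (bigD1 (lshift m a)) //=.
  by rewrite confluent_nodesl !hornerE subrr /= mul0r.
case: (split_ordP l) lt_li => [b|t] -> lt_li.
  rewrite prod_confluent_nodes_gtl confluent_formr_exp.
  by rewrite ltn_subrL /= (leq_ltn_trans _ (ltn_ord s)).
rewrite prod_confluent_nodes_gtr -[_ ^+ _]mul1r confluent_formr_exp.
by move: lt_li; rewrite /= ltn_add2l => lt_ts; rewrite ifT //; have := ltn_ord
    s; lia.
Qed.

(** Only the first k forms contribute: each of the last m reads the coefficient of (X - 1)^(m-r-1)
    in that very power, which is 1. *)
Lemma prod_confluent_form_diag :
  \prod_(i < k + m) phi i (\prod_(a < k + m | (i < a)%N) ('X - (u a)%:P)) =
  (\prod_(i < k) \prod_(j < k | (i < j)%N) (x i - x j))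
  * \prod_(i < k) (x i - 1) ^+ m.
Proof.
rewrite big_split_ord /= [X in _ * X]big1 ?mulr1 => [|r _]; last first.
  rewrite prod_confluent_nodes_gtr -[_ ^+ _]mul1r confluent_formr_exp ltnn.
  by rewrite subnn comp_polyC coef1.
rewrite -big_split; apply: eq_bigr => a _ /=.
rewrite prod_confluent_nodes_gtl confluent_forml hornerM horner_prod horner_exp
    !hornerE.
by congr (_ * _); apply: eq_bigr => b _; rewrite !hornerE.
Qed.

End Confluent.

(** * Evaluation of Schur functions *)

Lemma det_scale_rows (A : comNzRingType) (n : nat) (a : 'I_n -> A)
    (F : 'I_n -> 'I_n -> A) :
  \det (\matrix_(i, j) (a i * F i j)) =
  (\prod_i a i) * \det (\matrix_(i, j) F i j).
Proof.
transitivity (\det (diag_mx (\row_i a i) *m \matrix_(i, j) F i j)).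
  by congr (\det _); apply/matrixP=> i j; rewrite mul_diag_mx !mxE.
rewrite det_mulmx det_diag; congr (_ * _).
by apply: eq_bigr => i _; rewrite mxE.
Qed.

Lemma newton_matrix (A : comNzRingType) (n : nat) (u : 'I_n -> A)
    (p : 'I_n -> {poly A}) :
  exists (C : 'M[A]_n) (q : 'I_n -> {poly A}), forall j,
    p j = \sum_l C l j *: \prod_(a < n | (l < a)%N) ('X - (u a)%:P)
          + q j * \prod_(a < n) ('X - (u a)%:P).
Proof.
have /fin_all_exists [c] := fun j => newton_expansion u (p j).
case/fin_all_exists=> q Dp; exists (\matrix_(l, j) c j l), q => j.
rewrite {1}Dp; congr (_ + _).
by apply: eq_bigr => l _; rewrite mxE.
Qed.

Lemma vdm_neq0 (K : fieldType) (n : nat) (x : 'I_n -> K) :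
  injective x -> vdm x != 0.
Proof.
move=> x_inj; apply/prodf_neq0 => i _; apply/prodf_neq0 => j lt_ij.
by rewrite subr_eq0 (inj_eq x_inj) -val_eqE ltn_eqF.
Qed.

Lemma tofrac_inj (D : idomainType) : injective (@FracField.tofrac D).
Proof. by move=> p q /eqP; rewrite tofrac_eq => /eqP. Qed.

Lemma rfX_inj (R : fieldType) (n : nat) : injective (@rfX R n).
Proof.
move=> i j /tofrac_inj /(congr1 (mcoeff U_(i)%MM)).
rewrite !mcoeffX eqxx; case: eqP => [/(congr1 (fun m : 'X_{1.. n} => m i))|_
    /eqP].
  by rewrite !mnm1E eqxx; case: eqP => // ->.
by rewrite oner_eq0.
Qed.

Lemma rfX_neq0 (R : fieldType) (n : nat) (i : 'I_n) : rfX R i != 0.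
Proof.
rewrite tofrac_eq0; apply/eqP => /(congr1 (mcoeff U_(i)%MM)) /eqP.
by rewrite mcoeffX eqxx mcoeff0 oner_eq0.
Qed.

Lemma rfX_neq1 (R : fieldType) (n : nat) (i : 'I_n) : rfX R i != 1.
Proof.
rewrite -(rmorph1 (@FracField.tofrac _)) tofrac_eq.
apply/eqP => /(congr1 (mcoeff U_(i)%MM)) /eqP.
by rewrite mcoeffX eqxx mcoeff1 mnm1_eq0 oner_eq0.
Qed.

Lemma horner_prod_XsubC0 (A : comNzRingType) (n : nat) (u : 'I_n -> A)
    (P : pred 'I_n) (i : 'I_n) : P i ->
  (\prod_(a < n | P a) ('X - (u a)%:P)).[u i] = 0.
Proof.
by move=> Pi; rewrite horner_prod (bigD1 i) //= !hornerE subrr mul0r.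
Qed.

(** Evaluations at the nodes are triangular on the Newton basis, and their diagonal is the
    Vandermonde product. *)
Lemma alternant_newton (A : comNzRingType) (n : nat) (u : 'I_n -> A)
    (p q : 'I_n -> {poly A}) (C : 'M[A]_n) :
  (forall j, p j = \sum_l C l j *: \prod_(a < n | (l < a)%N) ('X - (u a)%:P)
                   + q j * \prod_(a < n) ('X - (u a)%:P)) ->
  \det (\matrix_(i, j) (p j).[u i]) =
  (\prod_(i < n) \prod_(j < n | (i < j)%N) (u i - u j)) * \det C.
Proof.
move=> Dp.
pose phi i : {scalar {poly A}} := horner_eval (u i).
rewrite -[LHS]/(\det (\matrix_(i, j) phi i (p j))).
rewrite (det_linear_forms_newton (phi := phi) _ _ Dp) => [|i r|i l lt_li].
- congr (_ * _); apply: eq_bigr => i _; rewrite /phi /= /horner_eval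
    horner_prod.
  by apply: eq_bigr => j _; rewrite !hornerE.
- by rewrite /phi /= /horner_eval hornerM horner_prod_XsubC0 ?mulr0.
by rewrite /phi /= /horner_eval horner_prod_XsubC0.
Qed.

Section SchurEval.

Variables (R : fieldType) (N : nat) (lam : 'I_N -> int).
Variables (nu : 'I_N -> nat) (B : nat).
Hypothesis Dnu : forall j, lam j + N%:Z - j.+1%:Z = (nu j)%:Z - B%:Z.

(** The exponents may be negative, so x_i^(-B) is taken out of each row. The remaining alternant of
    monomials is the Vandermonde product times det C, and the quotient by that product is an
    explicit Laurent form. *)
Lemma schur_newton (C : 'M[{mpoly R[N]}]_N) (q : 'I_N -> {poly {mpoly R[N]}}) :
  (forall j, 'X^(nu j) =
     \sum_l C l j *: \prod_(a < N | (l < a)%N) ('X - ('X_a)%:P)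
     + q j * \prod_(a < N) ('X - ('X_a)%:P)) ->
  schur R lam = FracField.tofrac (\det C) / (\prod_i rfX R i) ^+ B.
Proof.
move=> DX; rewrite /schur.
have -> : \det (\matrix_(i < N, j < N) rfX R i ^ (lam j + N%:Z - j.+1%:Z)) =
    vdm (rfX R (n := N)) * (FracField.tofrac (\det C) / (\prod_i rfX R i) ^+ B).
  transitivity (\det (\matrix_(i, j) ((rfX R i ^+ B)^-1 * rfX R i ^+ nu j))).
    congr (\det _); apply/matrixP => i j; rewrite !mxE Dnu expfzDr ?rfX_neq0 //.
    by rewrite mulrC -invr_expz.
  rewrite (det_scale_rows (fun i => (rfX R i ^+ B)^-1)) prodfV prodrXl mulrA
      mulrC.
  congr (_ / _).
  have := congr1 (@FracField.tofrac _) (alternant_newton DX).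
  rewrite -det_map_mx rmorphM rmorph_prod.
  under eq_bigr do rewrite rmorph_prod.
  under eq_bigr do under eq_bigr do rewrite rmorphB.
  move=> <-; congr (\det _); apply/matrixP => i j.
  by rewrite !mxE hornerXn rmorphXn.
by rewrite mulrC mulKf // vdm_neq0 //; apply: rfX_inj.
Qed.

(** Two Laurent forms of [f] give, after cross-multiplication, an identity of polynomials, which
    survives evaluation at [v]; nonzero coordinates allow dividing back. *)
Lemma laurent_evalE (K : fieldType) (iota : {rmorphism R -> K})
    (f : ratfun R N) (v : 'I_N -> K) p n :
  (forall i, v i != 0) -> laurent_form f (p, n) ->
  laurent_eval iota f v = mmap iota v p / (\prod_(i < N) v i) ^+ n.
Proof.
move=> v_neq0 Df; rewrite /laurent_eval.
have := epsilon_spec (inhabits (0, 0%N)) (laurent_form f) (ex_intro _ _ Df).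
case: (epsilon _ _) => p' n'; rewrite {}Df /laurent_form /=.
have U_neq0 e : (\prod_(i < N) rfX R i) ^+ e != 0.
  by rewrite expf_neq0 //; apply/prodf_neq0 => i _; apply: rfX_neq0.
have V_neq0 e : (\prod_(i < N) v i) ^+ e != 0.
  by rewrite expf_neq0 //; apply/prodf_neq0.
move/eqP; rewrite eqr_div ?U_neq0 //.
have -> : \prod_(i < N) rfX R i = FracField.tofrac (\prod_(i < N) 'X_i).
  by rewrite rmorph_prod.
rewrite -!rmorphXn -!rmorphM /= => /eqP /tofrac_inj /(congr1 (mmap iota v)).
rewrite !rmorphM !rmorphXn rmorph_prod /= => E.
apply/eqP; rewrite eqr_div //; apply/eqP.
have DV : \prod_(i < N) v i = \prod_(i < N) mmap iota v 'X_i.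
  by apply: eq_bigr => i _; rewrite mmapX mmap1U.
by rewrite DV.
Qed.

(** The expansion is made at the generic nodes X_a and then specialised. Its image is still a Newton
    expansion at the coordinates of [v], even when these coincide. *)
Lemma schur_eval_newton (K : fieldType) (iota : {rmorphism R -> K})
    (v : 'I_N -> K) : (forall i, v i != 0) ->
  exists (C : 'M[K]_N) (q : 'I_N -> {poly K}),
    (forall j, 'X^(nu j) =
       \sum_l C l j *: \prod_(a < N | (l < a)%N) ('X - (v a)%:P)
       + q j * \prod_(a < N) ('X - (v a)%:P)) /\
    laurent_eval iota (schur R lam) v = \det C / (\prod_i v i) ^+ B.
Proof.
move=> v_neq0.
have [C [q DX]] := newton_matrix (fun a : 'I_N => 'X_a : {mpoly R[N]})
                     (fun j => 'X^(nu j)).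
pose f : {rmorphism {mpoly R[N]} -> K} := mmap iota v.
exists (map_mx f C), (fun j => map_poly f (q j)); split=> [j|].
  have fX (P : pred 'I_N) :
      map_poly f (\prod_(a < N | P a) ('X - ('X_a : {mpoly R[N]})%:P)) =
      \prod_(a < N | P a) ('X - (v a)%:P).
    rewrite rmorph_prod; apply: eq_bigr => a _.
    by rewrite rmorphB /= map_polyX map_polyC /= mmapX mmap1U.
  have := congr1 (map_poly f) (DX j).
  rewrite rmorphXn /= map_polyX => ->; rewrite rmorphD rmorphM rmorph_sum /= fX.
  by congr (_ + _); apply: eq_bigr => l _; rewrite map_polyZ fX mxE.
by rewrite (laurent_evalE _ v_neq0 (schur_newton DX)) det_map_mx.
Qed.

End SchurEval.

(** * Lagrange weights *)

Definition lagrange_weight (K : fieldType) (n : nat) (y : 'I_n -> K)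
    (a : 'I_n) : K := (\prod_(b | b != a) (y a - y b))^-1.

(** The difference of q and its Lagrange interpolant has n roots and size at most n, so it is zero.
    Each interpolation polynomial [e a] is monic of degree n - 1, and the top coefficients are
    compared. *)
Lemma lagrange_lead_coef (K : fieldType) (n : nat) (y : 'I_n -> K)
    (q : {poly K}) :
  injective y -> (size q <= n)%N ->
  \sum_a lagrange_weight y a * q.[y a] = q`_n.-1.
Proof.
case: n y => [|n] y.
  by move=> _; rewrite leqn0 size_poly_eq0 => /eqP ->; rewrite big_ord0 coef0.
move=> y_inj le_q_n.
pose w a := lagrange_weight y a * q.[y a].
pose e a := \prod_(b | b != a) ('X - (y b)%:P).
have size_e a : size (e a) = n.+1.
  rewrite /e -big_filter size_prod_XsubC size_filter -sum1_count sum1_card.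
  by rewrite cardC1 card_ord.
have monic_e a : (e a)`_n = 1.
  have /monicP : e a \is monic by rewrite /e -big_filter monic_prod_XsubC.
  by rewrite /lead_coef size_e.
have : q - \sum_a w a *: e a = 0.
  apply: (@roots_geq_poly_eq0 _ _ [seq y a | a <- enum 'I_n.+1]).
  - apply/allP => _ /mapP [a _ ->]; rewrite /root hornerD hornerN horner_sum.
    rewrite (bigD1 a) //= big1 ?addr0 => [|b ne_ba]; last first.
      rewrite hornerZ horner_prod (bigD1 a) 1?eq_sym //= !hornerE subrr /=.
      by rewrite mulr0 mul0r.
    rewrite hornerZ horner_prod /w /lagrange_weight.
    under [X in _ - _ * X]eq_bigr do rewrite !hornerE.
    rewrite mulrAC mulVf ?mul1r ?subrr //; apply/prodf_neq0 => b ne_ba.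
    by rewrite subr_eq0 (inj_eq y_inj) eq_sym.
  - by rewrite map_inj_uniq ?enum_uniq.
  rewrite size_map size_enum_ord (leq_trans (size_polyD _ _)) // geq_max le_q_n.
  rewrite size_polyN (leq_trans (size_sum _ _ _)) //; apply/bigmax_leqP => a _.
  by rewrite (leq_trans (size_scale_leq _ _)) ?size_e.
move/eqP; rewrite subr_eq0 => /eqP Dq; rewrite [in RHS]Dq coef_sum.
by apply: eq_bigr => a _; rewrite coefZ monic_e mulr1.
Qed.

Lemma coef_Xn_shift (A : comNzRingType) (n d : nat) :
  ('X^n \Po ('X + 1 : {poly A}))`_d = 'C(n, d)%:R.
Proof.
rewrite rmorphXn /= comp_polyX exprD1n coef_sum.
under eq_bigr do rewrite coefMn coefXn.
case: (ltnP d n.+1) => [lt_dn|lt_nd].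
  rewrite (bigD1 (Ordinal lt_dn)) //= eqxx big1 ?addr0 // => i.
  by rewrite -val_eqE /= eq_sym => /negbTE ->; rewrite mul0rn.
rewrite bin_small // big1 // => i _.
by rewrite gtn_eqF ?mul0rn // (leq_trans (ltn_ord i)).
Qed.

Lemma natr_ffact (A : comNzRingType) (n d : nat) :
  (n ^_ d)%:R = \prod_(i < d) (n%:R - i%:R) :> A.
Proof.
elim: d => [|d IHd]; first by rewrite big_ord0.
rewrite ffactnSr natrM IHd big_ord_recr /=.
(* For n < d the truncated difference n - d is not the one in the ring, but the factor at i = n
   makes both sides vanish. *)
case: (leqP d n) => [le_dn|lt_nd]; first by rewrite natrB.
by rewrite (bigD1 (Ordinal lt_nd)) //= subrr !mul0r.
Qed.

(** * The confluent alternant times a weighted Vandermonde matrix *)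

Section ConfluentAlternant.

Variables (K : fieldType) (k m : nat) (x : 'I_k -> K).
Variables (nu : 'I_(k + m) -> nat) (y : 'I_(k + m) -> K) (b : K).
Hypothesis fact_neq0 : forall n, n`!%:R != 0 :> K.
Hypothesis y_inj : injective y.
Hypothesis Dy : forall a, (nu a)%:R = y a + b.

Local Notation c := (lagrange_weight y).

(** The binomial coefficient C(Y + b, d) as a polynomial in Y: the entries of the alternant depend
    on nu_a, while the weights use y_a = nu_a - b. *)
Let binp (d : nat) : {poly K} := (d`!%:R)^-1 *: \prod_(i < d) ('X - (i%:R -
    b)%:P).

Lemma binp_nodes d a : (binp d).[y a] = 'C(nu a, d)%:R.
Proof.
apply: (mulfI (fact_neq0 d)).
rewrite -natrM mulnC bin_ffact natr_ffact hornerZ mulrA mulfV ?mul1r //.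
rewrite horner_prod; apply: eq_bigr => i _.
by rewrite !hornerE Dy opprB addrA.
Qed.

Lemma size_binp d : (size (binp d) <= d.+1)%N.
Proof.
by rewrite (leq_trans (size_scale_leq _ _)) // size_prod_XsubC /index_enum
    -enumT size_enum_ord.
Qed.

Lemma coef_binp d : (binp d)`_d = (d`!%:R)^-1.
Proof.
have := monic_prod_XsubC (index_enum 'I_d) predT (fun i : 'I_d => i%:R - b).
move/monicP; rewrite /lead_coef size_prod_XsubC {2}/index_enum -enumT
    size_enum_ord /=.
by rewrite coefZ => ->; rewrite mulr1.
Qed.

(** The sum is the coefficient of index k + m - 1 of [binp d * 'X^j], whose degree is at most d + j;
    it is the leading coefficient 1/d! or zero. *)
Lemma sum_binp d j : (d + j < k + m)%N ->
  \sum_a 'C(nu a, d)%:R * (c a * y a ^+ j) =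
  if (d + j.+1 == k + m)%N then (d`!%:R)^-1 else 0.
Proof.
move=> le_dj.
transitivity ((binp d * 'X^j)`_(k + m).-1); last first.
  rewrite coefMXn; case: eqP => [<-|ne_dj].
    by rewrite addnS /= addnK ltnNge leq_addl coef_binp.
  case: ltnP => // le_j; rewrite nth_default // (leq_trans (size_binp d)) //;
      lia.
rewrite -(lagrange_lead_coef y_inj); last first.
  have [->|nz] := eqVneq (binp d) 0; first by rewrite mul0r size_poly0.
  by rewrite size_mulXn //; have := size_binp d; lia.
by apply: eq_bigr => a _; rewrite hornerM hornerXn binp_nodes mulrCA.
Qed.

Lemma det_confluent_alternant :
  \det (\matrix_(i, a) confluent_form x i 'X^(nu a))
    * (\prod_a c a * \prod_(a < k + m) \prod_(a' < k + m | (a < a')%N) (y a' -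
        y a)) =
  \det (\matrix_(i < k, j < k) \sum_a c a * y a ^+ j * x i ^+ nu a)
    * \prod_(r < m) ((m - r.+1)`!%:R)^-1.
Proof.
pose M := \matrix_(i < k + m, a < k + m) confluent_form x i 'X^(nu a).
pose CV := \matrix_(a < k + m, j < k + m) (c a * y a ^+ j).
have -> : \prod_a c a * \prod_(a < k + m) \prod_(a' < k + m | (a < a')%N) (y a'
    - y a)
    = \det CV.
  transitivity (\det (diag_mx (\row_a c a) *m (Vandermonde (k + m) (\row_a y
      a))^T)).
    rewrite det_mulmx det_diag det_tr det_Vandermonde.
    congr (_ * _); apply: eq_bigr => a _; first by rewrite mxE.
    by apply: eq_bigr => a' _; rewrite !mxE.
  by congr (\det _); apply/matrixP=> a j; rewrite mul_diag_mx !mxE.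
rewrite -det_mulmx -(submxK (M *m CV)).
have MrE r (j : 'I_(k + m)) : (M *m CV) (rshift k r) j =
    \sum_a 'C(nu a, m - r.+1)%:R * (c a * y a ^+ j).
  rewrite mxE; apply: eq_bigr => a _.
  by rewrite !mxE confluent_formr coef_Xn_shift.
(* Row r has d = m - r - 1, so its first nonzero entry is in column k + r, outside the left
   block. *)
have -> : dlsubmx (M *m CV) = 0.
  apply/matrixP=> r j; rewrite 2!mxE MrE mxE sum_binp /=.
    by rewrite ifF //; have := ltn_ord r; have := ltn_ord j; lia.
  by have := ltn_ord r; have := ltn_ord j; lia.
rewrite det_ublock; congr (_ * _).
  congr (\det _); apply/matrixP=> i j; rewrite 2!mxE [LHS]mxE [RHS]mxE.
  by apply: eq_bigr => a _; rewrite !mxE confluent_forml hornerXn mulrC.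
(* In the lower right block that first nonzero entry lies on the diagonal, so the block is upper
   triangular. *)
rewrite -det_tr det_trig.
  apply: eq_bigr => r _; rewrite 3!mxE MrE sum_binp /=; have := ltn_ord r; last
      lia.
  by move=> ltr; rewrite ifT //; lia.
apply/is_trig_mxP => j r lt_jr; rewrite 3!mxE MrE sum_binp /=.
  by rewrite ifF //; have := ltn_ord r; lia.
by have := ltn_ord r; lia.
Qed.

End ConfluentAlternant.

Section SchurConfluent.

Variables (R K : fieldType) (iota : {rmorphism R -> K}) (N : nat).
Variables (lam : 'I_N -> int) (nu : 'I_N -> nat) (B : nat) (y : 'I_N -> K).
Hypothesis Dnu : forall j, lam j + N%:Z - j.+1%:Z = (nu j)%:Z - B%:Z.
Hypothesis fact_neq0 : forall n, n`!%:R != 0 :> K.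
Hypothesis y_inj : injective y.
Hypothesis Dy : forall a, (nu a)%:R = y a + B%:R.

Local Notation c := (lagrange_weight y).
Local Notation E := (\prod_a c a * \prod_(a < N) \prod_(a' < N | (a < a')%N) (y
    a' - y a)).

(** The confluent alternant is computed twice: through Newton coefficients it gives the Schur value,
    through Lagrange weights the k x k determinant. Taking k = 0 gives the value at 1^N. *)
Lemma schur_at_det (k m : nat) (x : 'I_k -> K) :
  N = (k + m)%N -> (forall i, x i != 0) ->
  schur_at iota lam [seq x i | i <- enum 'I_k] *
    ((\prod_i x i) ^+ B * (vdm x * \prod_i (x i - 1) ^+ m) * E) =
  \det (\matrix_(i < k, j < k) \sum_a c a * y a ^+ j * x i ^+ nu a)
    * \prod_(r < m) ((m - r.+1)`!%:R)^-1.
Proof.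
move=> DN x_neq0.
move: lam nu y Dnu y_inj Dy; rewrite {}DN => lam' nu' y' Dnu' y'_inj Dy'.
pose v := confluent_nodes (m := m) x.
have Dv : (fun i : 'I_(k + m) => nth 1 [seq x i | i <- enum 'I_k] i) = v.
  apply: functional_extensionality => i; rewrite /v.
  case: (split_ordP i) => a ->.
    by rewrite confluent_nodesl (nth_map a) ?size_enum_ord ?nth_ord_enum /=.
  by rewrite confluent_nodesr nth_default // size_map size_enum_ord leq_addr.
have v_neq0 i : v i != 0.
  rewrite /v; case: (split_ordP i) => a ->; first by rewrite confluent_nodesl.
  by rewrite confluent_nodesr oner_neq0.
have [C [q [DX]]] := schur_eval_newton Dnu' iota v_neq0.
rewrite /schur_at Dv => ->.
have -> : \prod_i v i = \prod_i x i.
  rewrite big_split_ord /= [X in _ * X]big1 ?mulr1 => [|r _].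
    by apply: eq_bigr => a _; rewrite /v confluent_nodesl.
  by rewrite /v confluent_nodesr.
rewrite -(det_confluent_alternant x fact_neq0 y'_inj Dy').
rewrite (det_linear_forms_newton (@confluent_form_prod0 _ _ _ x)
          (@confluent_form_trig _ _ _ x) DX) prod_confluent_form_diag.
have X_neq0 : (\prod_i x i) ^+ B != 0.
  by rewrite expf_neq0 //; apply/prodf_neq0.
rewrite !mulrA divfK //; congr (_ * _ * _).
by rewrite -[LHS]mulrA mulrC.
Qed.

End SchurConfluent.

(** * Derivation of rational functions *)

(** The hypotheses are p/q = p0/q0, cross-multiplied, and the derivative of that identity. This
    makes [rf_deriv] independent of the chosen representative. *)
Lemma quotient_rule_wd (A : comNzRingType) (p q dp dq p0 q0 dp0 dq0 : A) :
  p * q0 = p0 * q -> dp * q0 + p * dq0 = dp0 * q + p0 * dq ->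
  (dp0 * q0 - p0 * dq0) * q ^+ 2 = (dp * q - p * dq) * q0 ^+ 2.
Proof.
move=> E dE; have {dE} dE : dp0 * q = dp * q0 + p * dq0 - p0 * dq.
  by rewrite dE addrK.
transitivity (q0 * q * (dp0 * q) - dq0 * q * (p0 * q)); first by ring.
transitivity (q0 * q * (dp * q0) - q0 * dq * (p * q0)); last by ring.
rewrite dE -E; transitivity (q0 * q * (dp * q0) - q0 * dq * (p0 * q)).
  by ring.
by rewrite E.
Qed.

Lemma quotient_ruleD (F : fieldType) (p q p' q' dp dq dp' dq' : F) :
  q != 0 -> q' != 0 ->
  (((dp * q' + p * dq') + (dp' * q + p' * dq)) * (q * q')
     - (p * q' + p' * q) * (dq * q' + q * dq')) / (q * q') ^+ 2 =
  (dp * q - p * dq) / q ^+ 2 + (dp' * q' - p' * dq') / q' ^+ 2.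
Proof. by move=> q_neq0 q'_neq0; field; rewrite ?q_neq0 ?q'_neq0. Qed.

Lemma quotient_ruleM (F : fieldType) (p q p' q' dp dq dp' dq' : F) :
  q != 0 -> q' != 0 ->
  ((dp * p' + p * dp') * (q * q') - (p * p') * (dq * q' + q * dq'))
    / (q * q') ^+ 2 =
  (dp * q - p * dq) / q ^+ 2 * (p' / q') + p / q * ((dp' * q' - p' * dq') / q'
      ^+ 2).
Proof. by move=> q_neq0 q'_neq0; field; rewrite ?q_neq0 ?q'_neq0. Qed.

Section Derivation.

Variables (R : fieldType) (n : nat) (i : 'I_n).

Local Notation tofrac := (@FracField.tofrac {mpoly R[n]}).
Local Notation D := (@rf_deriv R n i).

Lemma denom_repr_neq0 (f : ratfun R n) : tofrac \d_(repr f) != 0.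
Proof. by rewrite tofrac_eq0 denom_ratioP. Qed.

Lemma frac_repr (f : ratfun R n) : f = tofrac \n_(repr f) / tofrac \d_(repr f).
Proof.
apply: (canRL (mulfK (denom_repr_neq0 f))).
rewrite -{1}[f]reprK; unlock FracField.tofrac.
rewrite -[LHS]FracField.pi_mul; apply/eqmodP.
rewrite /= FracField.equivfE /FracField.mulf.
rewrite !numden_Ratio ?mulf_neq0 ?oner_neq0 ?denom_ratioP //.
by rewrite !mulr1 mulrC.
Qed.

Lemma rf_deriv_div (p q : {mpoly R[n]}) : q != 0 ->
  D (tofrac p / tofrac q) = tofrac (mderiv i p * q - p * mderiv i q) / tofrac
      (q ^+ 2).
Proof.
move=> q_neq0; rewrite /rf_deriv.
set f := _ / tofrac q.
have d_neq0 := denom_repr_neq0 f.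
have : f = tofrac \n_(repr f) / tofrac \d_(repr f) by apply: frac_repr.
move: (\n_(repr f)) (\d_(repr f)) d_neq0 => p0 q0; rewrite {}/f tofrac_eq0 =>
    q0_neq0.
move/eqP; rewrite eqr_div ?tofrac_eq0 // -!(@tofracM {mpoly R[n]}) => /eqP
    /tofrac_inj /= E.
have E' := congr1 (mderiv i) E; rewrite !mderivM in E'.
apply/eqP; rewrite eqr_div ?tofrac_eq0 ?expf_neq0 // -!(@tofracM {mpoly R[n]});
    apply/eqP.
by congr tofrac; apply: quotient_rule_wd.
Qed.

Lemma rf_deriv_tofrac p : D (tofrac p) = tofrac (mderiv i p).
Proof.
rewrite -[tofrac p]divr1 -[1]/(tofrac 1) rf_deriv_div ?oner_neq0 //.
by rewrite -mpolyC1 mderivC mulr0 subr0 mpolyC1 mulr1 expr1n divr1.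
Qed.

Lemma rf_derivD f g : D (f + g) = D f + D g.
Proof.
rewrite (frac_repr f) (frac_repr g).
have := denom_ratioP (repr f); have := denom_ratioP (repr g).
have := denom_repr_neq0 f; have := denom_repr_neq0 g.
move: (\n_(repr f)) (\d_(repr f)) (\n_(repr g)) (\d_(repr g)).
move=> p q p' q' tq'_neq0 tq_neq0 q'_neq0 q_neq0.
rewrite (addf_div _ _ tq_neq0 tq'_neq0) -!(@tofracM {mpoly R[n]}).
rewrite -(@tofracD {mpoly R[n]}) (rf_deriv_div _ (mulf_neq0 q_neq0 q'_neq0)).
rewrite (rf_deriv_div _ q_neq0) (rf_deriv_div _ q'_neq0).
rewrite mderivD !mderivM !(@tofracB {mpoly R[n]}, @tofracXn {mpoly R[n]},
  @tofracD {mpoly R[n]}, @tofracM {mpoly R[n]}).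
exact: quotient_ruleD tq_neq0 tq'_neq0.
Qed.

Lemma rf_derivM f g : D (f * g) = D f * g + f * D g.
Proof.
rewrite (frac_repr f) (frac_repr g).
have := denom_ratioP (repr f); have := denom_ratioP (repr g).
have := denom_repr_neq0 f; have := denom_repr_neq0 g.
move: (\n_(repr f)) (\d_(repr f)) (\n_(repr g)) (\d_(repr g)).
move=> p q p' q' tq'_neq0 tq_neq0 q'_neq0 q_neq0.
rewrite mulf_div -!(@tofracM {mpoly R[n]}).
rewrite (rf_deriv_div _ (mulf_neq0 q_neq0 q'_neq0)).
rewrite (rf_deriv_div _ q_neq0) (rf_deriv_div _ q'_neq0).
rewrite !mderivM !(@tofracB {mpoly R[n]}, @tofracXn {mpoly R[n]},
  @tofracD {mpoly R[n]}, @tofracM {mpoly R[n]}).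
exact: quotient_ruleM tq_neq0 tq'_neq0.
Qed.

End Derivation.

(** * Normalised Schur functions as determinants *)

Definition shifted_part (N : nat) (lam : 'I_N -> int) (j : 'I_N) : int :=
  lam j + N%:Z - j.+1%:Z.

(** Weakly decreasing parts plus the strictly decreasing -j give a strictly decreasing sequence. *)
Lemma shifted_part_inj (N : nat) (lam : 'I_N -> int) :
  is_signature lam -> injective (shifted_part lam).
Proof.
move=> lam_sig i j; rewrite /shifted_part => E; apply: val_inj => /=.
by case: (leqP i j) => [le_ij|/ltnW le_ij]; have := lam_sig _ _ le_ij; lia.
Qed.

Lemma det_scale_cols (A : comNzRingType) (n : nat) (b : 'I_n -> A)
    (F : 'I_n -> 'I_n -> A) :
  \det (\matrix_(i, j) (b j * F i j)) =
  (\prod_i b i) * \det (\matrix_(i, j) F i j).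
Proof.
rewrite -det_tr -[X in _ * X]det_tr.
transitivity (\det (\matrix_(j, i) (b j * F i j))).
  by congr (\det _); apply/matrixP => i j; rewrite !mxE.
rewrite (det_scale_rows b (fun j i => F i j)); congr (_ * \det _).
by apply/matrixP => i j; rewrite !mxE.
Qed.

(** Divide the instance (k, m) of [schur_at_det] by the instance (0, N): the factor [E] of the
    weights cancels, and the remaining constants are distributed over rows and columns. *)
Lemma schur_norm_det (R K : fieldType) (iota : {rmorphism R -> K})
    (N k m : nat) (lam : 'I_N -> int) (x : 'I_k -> K)
    (y := fun a => (shifted_part lam a)%:~R : K) :
  N = (k + m)%N -> (forall n, n`!%:R != 0 :> K) -> injective y ->
  injective x -> (forall i, x i != 0) -> (forall i, x i != 1) ->
  schur_norm iota lam [seq x i | i <- enum 'I_k] =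
  (vdm x)^-1 * \det (\matrix_(i < k, j < k)
    ((N - j.+1)`!%:R / (x i - 1) ^+ m *
      \sum_a lagrange_weight y a * y a ^+ j * x i ^ shifted_part lam a)).
Proof.
move=> DN fact_neq0 y_inj x_inj x_neq0 x_neq1.
(* This bounds every |mu_a|, so all mu_a + B are nonnegative. *)
pose B := (\sum_a `|shifted_part lam a|)%N.
pose nu a := absz (shifted_part lam a + B%:Z).
have Dmu a : shifted_part lam a = (nu a)%:Z - B%:Z.
  have : (absz (shifted_part lam a) <= B)%N by rewrite /B (bigD1 a) //=
      leq_addr.
  by rewrite /nu; lia.
have Dy a : (nu a)%:R = y a + B%:R.
  by rewrite /y Dmu rmorphB /= subrK.
have Hk := schur_at_det iota Dmu fact_neq0 y_inj Dy DN x_neq0.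
have H0 := schur_at_det iota Dmu fact_neq0 y_inj Dy (k := 0) (m := N)
  (x := fun=> 1) erefl (fun=> oner_neq0 _).
rewrite (size0nil (size_enum_ord 0)) /= det_mx00 /vdm !big_ord0 in H0.
rewrite expr1n !mul1r in H0.
move: Hk H0; set E := (X in _ * (_ * X) = _ -> _); set F := \det _.
set s := schur_at _ _ _; set s0 := schur_at _ _ _ => Hk H0.
have E_neq0 : E != 0.
  rewrite /E mulf_neq0 //; apply/prodf_neq0 => a _.
    by rewrite invr_eq0; apply/prodf_neq0 => b ne_ba; rewrite subr_eq0 (inj_eq
        y_inj) eq_sym.
  by apply/prodf_neq0 => b lt_ab; rewrite subr_eq0 (inj_eq y_inj) -val_eqE
      gtn_eqF.
have -> : \det (\matrix_(i < k, j < k) ((N - j.+1)`!%:R / (x i - 1) ^+ m *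
      \sum_a lagrange_weight y a * y a ^+ j * x i ^ shifted_part lam a)) =
    (\prod_i (x i ^+ B * (x i - 1) ^+ m)^-1) * ((\prod_(j < k) (N - j.+1)`!%:R)
        * F).
  rewrite -det_scale_cols -det_scale_rows; congr (\det _); apply/matrixP => i j.
  rewrite !mxE invfM -!mulrA mulrCA [RHS]mulrCA; congr (_ * _).
  rewrite [RHS]mulrCA; congr (_ * _); rewrite mulr_sumr; apply: eq_bigr => a _.
  by rewrite Dmu expfzDr // -invr_expz mulrA [RHS]mulrC.
have -> : \prod_i (x i ^+ B * (x i - 1) ^+ m)^-1 =
    ((\prod_i x i) ^+ B * \prod_i (x i - 1) ^+ m)^-1.
  by rewrite prodfV big_split prodrXl.
have fact_prod n : \prod_(r < n) ((n - r.+1)`!%:R)^-1 != 0 :> K.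
  by apply/prodf_neq0 => r _; rewrite invr_eq0.
(* Of the N factorials, those of index k + r are the (m - r - 1)! and cancel; the first k remain. *)
have -> : \prod_(j < k) (N - j.+1)`!%:R =
    \prod_(r < m) ((m - r.+1)`!%:R)^-1 / \prod_(r < N) ((N - r.+1)`!%:R)^-1 :>
        K.
  rewrite -prodfV DN big_split_ord /= mulrC -mulrA -[LHS]mulr1.
  under [X in _ = X * _]eq_bigr do rewrite invrK.
  congr (_ * _); rewrite -big_split big1 // => r _ /=.
  by rewrite invrK -addnS subnDl mulfV.
have X_neq0 : (\prod_i x i) ^+ B != 0 by rewrite expf_neq0 //; apply/prodf_neq0.
have P_neq0 : \prod_i (x i - 1) ^+ m != 0.
  by apply/prodf_neq0 => i _; rewrite expf_neq0 // subr_eq0.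
have V_neq0 : vdm x != 0 by apply: vdm_neq0.
rewrite /schur_norm -/s -/s0.
have -> : s0 = \prod_(r < N) ((N - r.+1)`!%:R)^-1 / E by rewrite -H0 mulfK.
have -> : s = F * \prod_(r < m) ((m - r.+1)`!%:R)^-1 /
    ((\prod_i x i) ^+ B * (vdm x * \prod_i (x i - 1) ^+ m) * E).
  by rewrite -Hk mulfK //; exact: mulf_neq0 (mulf_neq0 X_neq0 (mulf_neq0 V_neq0
      P_neq0)) E_neq0.
have WN_neq0 := fact_prod N.
move: (\prod_(r < N) _) WN_neq0 => WN WN_neq0.
by field; rewrite ?WN_neq0 ?P_neq0 ?X_neq0 ?E_neq0 ?V_neq0.
Qed.

Lemma schur_norm1 (R K : fieldType) (iota : {rmorphism R -> K})
    (N : nat) (lam : 'I_N -> int) (x : K)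
    (y := fun a => (shifted_part lam a)%:~R : K) :
  (0 < N)%N -> (forall n, n`!%:R != 0 :> K) -> injective y ->
  x != 0 -> x != 1 ->
  schur_norm iota lam [:: x] * (x - 1) ^+ N.-1 =
  \sum_a N.-1`!%:R * lagrange_weight y a * x ^ shifted_part lam a.
Proof.
move=> N_gt0 fact_neq0 y_inj x_neq0 x_neq1.
have -> : [:: x] = [seq x | _ <- enum 'I_1].
  by have -> : enum 'I_1 = [:: ord0]
    by apply: (inj_map val_inj); rewrite val_enum_ord.
rewrite (schur_norm_det iota (k := 1) (esym (prednK N_gt0)) fact_neq0 y_inj)
    //; last first.
  by move=> a b _; rewrite !ord1.
rewrite /vdm big_ord1 big_pred0 => [|a]; last by rewrite (ord1 a).
rewrite invr1 mul1r det_mx11 mxE subn1 mulrAC divfK ?expf_neq0 ?subr_eq0 //.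
by rewrite mulr_sumr; apply: eq_bigr => a _; rewrite expr0 mulr1 mulrA.
Qed.

(** * The operator x d/dx *)

Section EulerOperator.

Variables (K : fieldType) (D : K -> K).
Hypothesis DD : forall f g, D (f + g) = D f + D g.
Hypothesis DM : forall f g, D (f * g) = D f * g + f * D g.

Lemma derivation0 : D 0 = 0.
Proof. by apply: (addrI (D 0)); rewrite -DD !addr0. Qed.

Lemma derivation_sum (I : Type) (r : seq I) (P : pred I) (F : I -> K) :
  D (\sum_(i <- r | P i) F i) = \sum_(i <- r | P i) D (F i).
Proof. exact: (big_morph D DD derivation0). Qed.

Lemma derivation1 : D 1 = 0.
Proof.
have := DM 1 1; rewrite !mulr1 mul1r => D1.
by apply: (addrI (D 1)); rewrite addr0 -D1.
Qed.

Lemma derivationN f : D (- f) = - D f.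
Proof. by apply: (addrI (D f)); rewrite -DD !subrr derivation0. Qed.

Lemma derivation_nat m : D m%:R = 0.
Proof.
by elim: m => [|m IHm]; rewrite ?derivation0 // mulrS DD derivation1 IHm addr0.
Qed.

Lemma derivation_int z : D z%:~R = 0.
Proof.
by case: z => m; rewrite ?NegzE ?rmorphN ?derivationN /= derivation_nat ?oppr0.
Qed.

Lemma derivation_const_prod (I : Type) (r : seq I) (P : pred I) (F : I -> K) :
  (forall i, P i -> D (F i) = 0) -> D (\prod_(i <- r | P i) F i) = 0.
Proof.
move=> DF; elim/big_rec: _ => [|i f Pi Df]; first exact: derivation1.
by rewrite DM Df DF // mul0r mulr0 addr0.
Qed.

Lemma derivation_const_inv c : D c = 0 -> D c^-1 = 0.
Proof.
have [->|c_neq0] := eqVneq c 0; first by rewrite invr0.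
move=> Dc; apply: (mulfI c_neq0); rewrite mulr0.
by have := DM c c^-1; rewrite mulfV // derivation1 Dc mul0r add0r => <-.
Qed.

Lemma iter_derivation_sum j (I : Type) (r : seq I) (P : pred I) (F : I -> K) :
  iter j D (\sum_(i <- r | P i) F i) = \sum_(i <- r | P i) iter j D (F i).
Proof. by elim: j => //= j ->; rewrite derivation_sum. Qed.

(** Induction with Pascal's rule; the extra last term vanishes because C(j, j + 1) = 0. *)
Lemma leibniz_iter j f g :
  iter j D (f * g) =
  \sum_(l < j.+1) 'C(j, l)%:R * iter l D f * iter (j - l) D g.
Proof.
elim: j f g => [|j IHj] f g; first by rewrite big_ord1 /= mul1r.
rewrite iterS IHj derivation_sum.
under eq_bigr => l _ do rewrite DM DM derivation_nat mul0r add0r.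
rewrite big_split [in RHS]big_ord_recl /= bin0.
under [in RHS]eq_bigr => l _ do rewrite binS natrD -mulrA mulrDl subSS.
rewrite big_split /= addrA [RHS]addrC; congr (_ + _).
  by apply: eq_bigr => l _; rewrite mulrA.
rewrite [in LHS]big_ord_recl /= bin0 subn0; congr (_ + _).
rewrite [in RHS]big_ord_recr /= bin_small // mul0r addr0.
apply: eq_bigr => l _; rewrite mulrA; congr (_ * _).
by rewrite /bump /= add1n -iterS subnSK.
Qed.

Variable x : K.
Hypothesis x_neq0 : x != 0.
Hypothesis Dx : D x = x.

Lemma euler_exp m : D (x ^+ m) = m%:R * x ^+ m.
Proof.
elim: m => [|m IHm]; first by rewrite expr0 derivation1 mul0r.
by rewrite exprS DM Dx IHm mulrCA -[X in X + _]mul1r -mulrDl -mulrS.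
Qed.

Lemma euler_exprz z : D (x ^ z) = z%:~R * x ^ z.
Proof.
case: z => m; first exact: euler_exp.
rewrite NegzE -invr_expz rmorphN /=; set X := x ^+ m.+1.
have X_neq0 : x ^ m.+1%:Z != 0 by rewrite expfz_neq0.
(* The value comes from differentiating x^(m+1) x^(-m-1) = 1. *)
apply: (mulfI X_neq0); apply: (addrI (D (x ^ m.+1%:Z) / x ^ m.+1%:Z)).
rewrite -DM mulfV // derivation1 [D _]euler_exp mulfK //.
by rewrite mulNr mulrN mulrCA mulfV // mulr1 subrr.
Qed.

Lemma iter_euler_exprz j c z : D c = 0 ->
  iter j D (c * x ^ z) = c * z%:~R ^+ j * x ^ z.
Proof.
move=> Dc; elim: j => [|j IHj]; first by rewrite /= expr0 mulr1.
rewrite iterS IHj DM euler_exprz.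
have -> : D (c * z%:~R ^+ j) = 0.
  by rewrite DM Dc mul0r add0r -rmorphXn derivation_int mulr0.
by rewrite mul0r add0r exprSr !mulrA.
Qed.

Lemma coef_poly_euler (p : {poly K}) l : (poly_euler p)`_l = p`_l *+ l.
Proof. by rewrite coefXM; case: l => [|l] //=; rewrite coef_deriv. Qed.

(** This links [D], acting on values in the field, to the formal operator inside [Pjl], which acts
    before evaluation. The coefficients stay constants of [D] at every iteration. *)
Lemma iter_euler_horner j (p : {poly K}) : (forall l, D p`_l = 0) ->
  iter j D p.[x] = (iter j (@poly_euler K) p).[x].
Proof.
elim: j p => // j IHj p Dp; rewrite !iterSr -IHj => [|l]; last first.
  by rewrite coef_poly_euler -mulr_natr DM Dp derivation_nat mul0r mulr0 addr0.
congr (iter j D _); rewrite horner_coef derivation_sum.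
rewrite (@horner_coef_wide _ (size p)); last first.
  apply/leq_sizeP => l le_pl.
  by rewrite coef_poly_euler nth_default ?mul0rn.
apply: eq_bigr => l _; rewrite DM Dp euler_exp mul0r add0r coef_poly_euler.
by rewrite mulrCA mulr_natl mulrnAl.
Qed.

Lemma iter_euler_Xsub1 j n :
  iter j D ((x - 1) ^+ n) = (iter j (@poly_euler K) (('X - 1) ^+ n)).[x].
Proof.
rewrite -iter_euler_horner; first by rewrite horner_exp !hornerE.
move=> l; have -> : ('X - 1) ^+ n = map_poly intr (('X - 1) ^+ n) :> {poly K}.
  by rewrite rmorphXn rmorphB rmorph1 /= map_polyX.
by rewrite coef_map /= derivation_int.
Qed.

Hypothesis x_neq1 : x != 1.
Hypothesis nat_neq0 : forall n, n.+1%:R != 0 :> K.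

(** Apply D^j to the hypothesis on S. The right side consists of eigenvectors x^mu_a with
    eigenvalues mu_a, and the Leibniz terms on the left match the summands one by one. *)
Lemma sum_euler_Pjl (N k j : nat) (S : K) (w : 'I_N -> K) (mu : 'I_N -> int) :
  (j < k <= N)%N -> (forall a, D (w a) = 0) ->
  S * (x - 1) ^+ N.-1 = \sum_a N.-1`!%:R * w a * x ^ mu a ->
  \sum_(l < j.+1) iter l D S / N%:R ^+ l * Pjl j.+1 l N x
      * (x - 1) ^+ (l + k - j.+1) =
  (N - j.+1)`!%:R / (x - 1) ^+ (N - k) *
    \sum_a w a * (mu a)%:~R ^+ j * x ^ mu a.
Proof.
case/andP=> lt_jk le_kN Dw DS.
have N_gt0 : (0 < N)%N by apply: leq_trans le_kN; apply: leq_trans lt_jk.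
have fact_neq0 n : n`!%:R != 0 :> K by rewrite -(prednK (fact_gt0 n)).
have N_neq0 : N%:R != 0 :> K by rewrite -(prednK N_gt0).
have x1_neq0 : x - 1 != 0 by rewrite subr_eq0.
have := congr1 (iter j D) DS; rewrite leibniz_iter iter_derivation_sum.
under [RHS]eq_bigr => a _.
  rewrite iter_euler_exprz; first over.
  by rewrite DM Dw derivation_nat mul0r mulr0 addr0.
move=> DL.
have -> : \sum_a w a * (mu a)%:~R ^+ j * x ^ mu a = (N.-1`!%:R)^-1 *
    \sum_(l < j.+1) 'C(j, l)%:R * iter l D S * iter (j - l) D ((x - 1) ^+ N.-1).
  by rewrite DL mulr_sumr; apply: eq_bigr => a _; rewrite -!mulrA mulKf.
rewrite !mulr_sumr; apply: eq_bigr => l _.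
rewrite iter_euler_Xsub1 /Pjl /=.
set W := _.[x]; set Sl := iter l _ _.
have Nl_neq0 : N%:R ^+ l != 0 :> K by rewrite expf_neq0.
(* The power in [Pjl] and the explicit one have exponents adding up to k - N for every l; l + k - (j
   + 1) is not truncated since j < k. *)
have -> : ((x - 1) ^+ (N - k))^-1 =
    (x - 1) ^ (j.+1%:Z - l%:Z - N%:Z) * (x - 1) ^+ (l + k - j.+1).
  rewrite [_ ^+ (l + k - j.+1)]exprnP -expfzDr // exprnP invr_expz.
  by congr (_ ^ _); have := ltn_ord l; lia.
move: (_ ^ _) (_ ^+ (l + k - _)) => X Y.
by field; rewrite Nl_neq0 fact_neq0.
Qed.

End EulerOperator.

(** * The Euler operator on rational functions *)

Section RationalFunctions.

Variables (R : numFieldType) (k : nat).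
Local Notation K := (ratfun R k).

Lemma ratfun_nat_neq0 n : (n.+1%:R : K) != 0.
Proof. by rewrite -(rmorph_nat (rfC R k)) fmorph_eq0 pnatr_eq0. Qed.

Lemma ratfun_int_inj : injective (fun z : int => z%:~R : K).
Proof.
move=> z1 z2; rewrite -!(rmorph_int (rfC R k)) => /fmorph_inj.
exact: intr_inj.
Qed.

Lemma ratfun_fact_neq0 n : (n`!%:R : K) != 0.
Proof. by rewrite -(prednK (fact_gt0 n)) ratfun_nat_neq0. Qed.

Variable i : 'I_k.

Lemma rf_eulerD (f g : K) : rf_euler i (f + g) = rf_euler i f + rf_euler i g.
Proof. by rewrite /rf_euler rf_derivD mulrDr. Qed.

Lemma rf_eulerM (f g : K) :
  rf_euler i (f * g) = rf_euler i f * g + f * rf_euler i g.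
Proof.
rewrite /rf_euler rf_derivM; move: (rf_deriv i f) (rf_deriv i g) => df dg.
by rewrite mulrDr mulrA (mulrCA f). Qed.

Lemma rf_eulerX : rf_euler i (rfX R i) = rfX R i.
Proof.
rewrite /rf_euler rf_deriv_tofrac mderivX mnm1E eqxx.
have -> : (U_(i) - U_(i) = 0)%MM by apply/mnmP => j; rewrite mnmBE mnm0E subnn.
by rewrite mpolyX0 scale1r tofrac1 mulr1.
Qed.

(** The weights are built from integers, hence are constants. *)
Lemma rf_euler_lagrange_weight (N : nat) (z : 'I_N -> int) (a : 'I_N) :
  rf_euler i (lagrange_weight (fun b => (z b)%:~R : K) a) = 0.
Proof.
rewrite /lagrange_weight; apply: (derivation_const_inv rf_eulerM).
apply: (derivation_const_prod rf_eulerM) => b _.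
by rewrite -rmorphB (derivation_int rf_eulerD rf_eulerM).
Qed.

End RationalFunctions.

(* Rows and columns are numbered from 0, so that column j of the matrix below
   is column j.+1 in the usual numbering. *)
Theorem proposition3p9 (R : numFieldType) (N k : nat) (lam : 'I_N -> int)
    (hlam : is_signature lam) (hk : (1 <= k <= N)%N) :
  schur_norm (rfC R k) lam [seq rfX R i | i <- enum 'I_k] =
  (vdm (rfX R (n := k)))^-1 *
  \det (\matrix_(i < k, j < k)
    \sum_(l < j.+1)
      iter l (@rf_euler R k i) (schur_norm (rfC R k) lam [:: rfX R i])
        / N%:R ^+ l
      * Pjl j.+1 l N (rfX R i)
      * (rfX R i - 1) ^+ (l + k - j.+1)).
Proof.
have [k_gt0 le_kN] := andP hk.
have N_gt0 : (0 < N)%N := leq_trans k_gt0 le_kN.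
have y_inj := inj_comp (@ratfun_int_inj R k) (shifted_part_inj hlam).
have fact_neq0 := @ratfun_fact_neq0 R k.
have -> := schur_norm_det (rfC R k) (esym (subnKC le_kN)) fact_neq0 y_inj
             (@rfX_inj R k) (@rfX_neq0 R k) (@rfX_neq1 R k).
(* The two matrices agree entry by entry: entry (i, j) is D_i^j applied to the one-variable formula
   [schur_norm1]. *)
congr (_ * \det _); apply/matrixP => i j; rewrite [LHS]mxE [RHS]mxE; symmetry.
have bounds : (j < k <= N)%N by rewrite ltn_ord le_kN.
exact: (sum_euler_Pjl (@rf_eulerD R k i) (@rf_eulerM R k i) (rfX_neq0 R i)
  (rf_eulerX R i) (rfX_neq1 R i) (@ratfun_nat_neq0 R k) bounds
  (rf_euler_lagrange_weight R i (shifted_part lam))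
  (schur_norm1 (rfC R k) N_gt0 fact_neq0 y_inj (rfX_neq0 R i) (rfX_neq1 R i))).
Qed.
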